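(* Let $n\ge 3$, let $\mathcal G$ be the 1-to-many graph on $\{1,\dots,n\}$ (edges $nj$, $j=1,\dots,n-1$), and let $(\mathcal G,\mathbf g)$ be a target bearing formation, $\mathbf g=(\mathbf g_{nj})_{j=1}^{n-1}$ with $\mathbf g_{nj}\in\mathbb S^{d-1}$, that satisfies Assumption 1. Assume that the initial leader positions satisfy $p_i(0)=\mathrm p_i$, $i=1,\dots,n-1$, for a configuration $\mathrm p=(\mathrm p_1,\dots,\mathrm p_n)\in F_B^{-1}(\mathbf g)$. Then the point $$\mathrm p_n=\Big(\sum_{j=1}^{n-1}P_{\mathbf g_{nj}}\Big)^{-1}\Big(\sum_{j=1}^{n-1}P_{\mathbf g_{nj}}\mathrm p_j\Big)$$ is a globally exponentially stable equilibrium of the dynamics $$\dot p_i(t)=0,\ i=1,\dots,n-1,\qquad \dot p_n(t)=-\sum_{j=1}^{n-1}P_{g_{nj}(t)}\mathbf g_{nj}.$$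
   Context: Agents have positions $p_i(t)\in\mathbb R^d$ (typically $d\in\{2,3\}$). The bearing is $g_{ij}=\frac{p_j-p_i}{\|p_j-p_i\|}\in\mathbb S^{d-1}$ and $g_{nj}(t)$ denotes the bearing evaluated along the trajectory. For $x\ne 0$, $P_x=I_d-\frac{xx^T}{\|x\|^2}$. The 1-to-many directed graph has leaders $1,\dots,n-1$ with no outgoing edges, and one follower $n$ with edges $nj$ to every leader $j$. The bearing function $F_B$ maps a configuration $p=(p_1,\dots,p_n)$ to the stacked vector of bearings $g_{nj}$, $j=1,\dots,n-1$. Assumption 1: the target bearing formation $(\mathcal G,\mathbf g)$ is realizable (i.e. $F_B^{-1}(\mathbf g)\neq\emptyset$), and there exists a configuration $\mathrm p\in F_B^{-1}(\mathbf g)$ such that $\mathrm p_i,\mathrm p_j,\mathrm p_n$ are not collinear for any distinct $i,j\in\{1,\dots,n-1\}$. Standing assumption: no inter-agent collisions occur, so that all bearings are well defined along trajectories. The stability statement concerns the follower state $p_n$, the leaders being stationary.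
   Formalization: ''Globally exponentially stable'' is taken with a constant uniform over all initial follower positions but a decay rate uniform only on each ball of initial positions; a rate uniform over the whole space is impossible because the follower's speed is at most n-1. *)

(* Defs.v *)
From mathcomp Require Import all_boot all_order all_algebra.
From mathcomp Require Import all_classical all_reals all_analysis.

Set Implicit Arguments.
Unset Strict Implicit.
Unset Printing Implicit Defensive.
Import Order.TTheory GRing.Theory Num.Theory.
Import numFieldNormedType.Exports.
Local Open Scope classical_set_scope.
Local Open Scope ring_scope.

(* The norm [`|x|] that MathComp-Analysis puts on matrices is the sup norm. *)
Definition enorm (R : realType) (d : nat) (x : 'cV[R]_d) : R :=
  Num.sqrt (\sum_(i < d) x i 0 ^+ 2).

Definition unit_sphere (R : realType) (d : nat) : set 'cV[R]_d :=
  [set x | enorm x = 1].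

(* P_x, meaningful for x != 0. *)
Definition orth_proj (R : realType) (d : nat) (x : 'cV[R]_d) : 'M[R]_d :=
  1%:M - (enorm x ^+ 2)^-1 *: (x *m x^T).

Definition collinear (R : realType) (d : nat) (a b c : 'cV[R]_d) : Prop :=
  exists x v : 'cV[R]_d, v != 0 /\
    forall y, [\/ y = a, y = b | y = c] -> exists s : R, y = x + s *: v.

(* There are n = m.+1 agents.  The follower is the last one, and the m leaders,
   which are also the heads of the m edges of the 1-to-many graph, are indexed
   by 'I_m. *)
Definition configuration (R : realType) (d m : nat) := 'I_m.+1 -> 'cV[R]_d.

Definition follower (m : nat) : 'I_m.+1 := ord_max.
Definition leader (m : nat) (j : 'I_m) : 'I_m.+1 := lift ord_max j.
Arguments follower {m}.

Definition bearing (R : realType) (d m : nat) (p : configuration R d m)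
    (i j : 'I_m.+1) : 'cV[R]_d :=
  (enorm (p j - p i))^-1 *: (p j - p i).

Definition bearings_defined (R : realType) (d m : nat)
    (p : configuration R d m) : Prop :=
  forall j : 'I_m, p (leader j) != p follower.

Definition bearing_function (R : realType) (d m : nat)
    (p : configuration R d m) : 'I_m -> 'cV[R]_d :=
  fun j => bearing p follower (leader j).

(* The preimage of g under the bearing function restricted to its domain. *)
Definition bearing_fiber (R : realType) (d m : nat) (g : 'I_m -> 'cV[R]_d) :
    set (configuration R d m) :=
  [set p | bearings_defined p /\ bearing_function p = g].

Definition realizable (R : realType) (d m : nat) (g : 'I_m -> 'cV[R]_d) : Prop :=
  bearing_fiber g !=set0.

Definition noncollinear_realizable (R : realType) (d m : nat)
    (g : 'I_m -> 'cV[R]_d) : Prop :=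
  realizable g /\
  exists2 p, bearing_fiber g p &
    forall i j : 'I_m, i != j ->
      ~ collinear (p (leader i)) (p (leader j)) (p follower).

Definition velocity (R : realType) (d m : nat) (g : 'I_m -> 'cV[R]_d)
    (p : configuration R d m) (i : 'I_m.+1) : 'cV[R]_d :=
  if i == follower then
    - \sum_(j < m) orth_proj (bearing p follower (leader j)) *m g j
  else 0.

(* Collision-free solutions on [0, +oo[.  Only the values for t >= 0 matter,
   so at t = 0 right-continuity replaces the two-sided derivative. *)
Definition trajectory (R : realType) (d m : nat) (g : 'I_m -> 'cV[R]_d)
    (p : R -> configuration R d m) : Prop :=
  [/\ forall t : R, 0 <= t -> bearings_defined (p t),
      forall i, p t i @[t --> 0^'+] --> p 0 i &
      forall t : R, 0 < t -> forall i : 'I_m.+1,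
        is_derive (t : R^o) 1 (fun s : R => p s i) (velocity g (p t) i)].

Definition equilibrium (R : realType) (d m : nat) (g : 'I_m -> 'cV[R]_d)
    (p : configuration R d m) : Prop :=
  bearings_defined p /\ forall i, velocity g p i = 0.

Definition place_follower (R : realType) (d m : nat)
    (p : configuration R d m) (x : 'cV[R]_d) : configuration R d m :=
  fun i => if i == follower then x else p i.

(* The curves p_n(t) along the trajectories whose leaders start as in q. *)
Definition follower_motions (R : realType) (d m : nat) (g : 'I_m -> 'cV[R]_d)
    (q : configuration R d m) : set (R -> 'cV[R]_d) :=
  [set y | exists p : R -> configuration R d m,
    [/\ trajectory g p,
        forall j : 'I_m, p 0 (leader j) = q (leader j) &
        forall t : R, y t = p t follower]].

(* The constant K is uniform over all initial states, and the rate lambda is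
   uniform over each ball of initial states.  The rate cannot be uniform over
   the whole space: the follower's speed is bounded by the number of leaders,
   so y t - x cannot have dropped to half of its initial size before a time
   proportional to that size. *)
Definition globally_exponentially_stable (R : realType) (d : nat)
    (motions : set (R -> 'cV[R]_d)) (x : 'cV[R]_d) : Prop :=
  exists2 K : R, 0 < K &
    forall r : R, 0 < r ->
      exists2 lambda : R, 0 < lambda &
        forall y : R -> 'cV[R]_d, motions y -> enorm (y 0 - x) <= r ->
          forall t : R, 0 <= t ->
            enorm (y t - x) <= K * expR (- lambda * t) * enorm (y 0 - x).

(* Main.v *)
(* Let x be the target position of the follower, e = p_n - x, and write the
   leaders as p_j = x + c_j g_j with c_j > 0.  With z_j = p_j - p_n = c_j g_j - e,
   the Gram determinants of (e, z_j) and (e, c_j g_j) agree, which gives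
     e . P_{z_j} g_j = c_j / |z_j|^2 (|e|^2 - (g_j . e)^2) >= 0,
   so |e|^2 is nonincreasing.  Hence |e| <= r and |z_j| <= c_j + r along the
   whole motion.  As two of the g_j are not parallel, the sum of the
   |e|^2 - (g_j . e)^2 is at least mu |e|^2 with mu > 0, and Gronwall's
   inequality applies with the rate mu min_j c_j / (c_j + r)^2. *)
Require Import Defs.
From mathcomp Require Import all_boot all_order all_algebra.
From mathcomp Require Import all_classical all_reals all_analysis.
From mathcomp Require Import ring lra.

Set Implicit Arguments.
Unset Strict Implicit.
Unset Printing Implicit Defensive.
Import Order.TTheory GRing.Theory Num.Theory.
Import numFieldNormedType.Exports.
Local Open Scope classical_set_scope.
Local Open Scope ring_scope.

(** * Euclidean inner product, norm and orthogonal projections *)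

Section Dot.
Context {R : realType} {d : nat}.
Implicit Types (u v w x : 'cV[R]_d) (c : R).

Definition dot u v : R := \sum_(i < d) u i 0 * v i 0.

Lemma dotC u v : dot u v = dot v u.
Proof. by apply: eq_bigr => i _; rewrite mulrC. Qed.

Lemma dotDr u v w : dot u (v + w) = dot u v + dot u w.
Proof. by rewrite /dot -big_split; apply: eq_bigr => i _; rewrite mxE mulrDr. Qed.

Lemma dotZr c u v : dot u (c *: v) = c * dot u v.
Proof. by rewrite /dot mulr_sumr; apply: eq_bigr => i _; rewrite mxE mulrCA. Qed.

Lemma dotNr u v : dot u (- v) = - dot u v.
Proof. by rewrite -scaleN1r dotZr mulN1r. Qed.

Lemma dotBr u v w : dot u (v - w) = dot u v - dot u w.
Proof. by rewrite dotDr dotNr. Qed.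

Lemma dotDl u v w : dot (u + v) w = dot u w + dot v w.
Proof. by rewrite !(dotC _ w) dotDr. Qed.

Lemma dotZl c u v : dot (c *: u) v = c * dot u v.
Proof. by rewrite !(dotC _ v) dotZr. Qed.

Lemma dotBl u v w : dot (u - v) w = dot u w - dot v w.
Proof. by rewrite !(dotC _ w) dotBr. Qed.

Lemma dot0r u : dot u 0 = 0.
Proof. by rewrite -(scale0r 0) dotZr mul0r. Qed.

Lemma dot_sumr (I : finType) u (F : I -> 'cV[R]_d) :
  dot u (\sum_i F i) = \sum_i dot u (F i).
Proof. exact: (big_morph (dot u) (dotDr u) (dot0r u)). Qed.

Lemma dotvv_ge0 u : 0 <= dot u u.
Proof. by apply: sumr_ge0 => i _; rewrite -expr2 sqr_ge0. Qed.

Lemma dotvv_eq0 u : (dot u u == 0) = (u == 0).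
Proof.
apply/eqP/eqP => [u0|->]; last exact: dot0r.
apply/matrixP => i j; rewrite ord1 mxE; apply/eqP; rewrite -sqrf_eq0 expr2.
by have /psumr_eq0P -> := u0 => // k _; rewrite -expr2 sqr_ge0.
Qed.

Lemma dotvv_gt0 u : (0 < dot u u) = (u != 0).
Proof. by rewrite lt0r dotvv_ge0 andbT dotvv_eq0. Qed.

Lemma enorm_sqr u : enorm u ^+ 2 = dot u u.
Proof.
have E : \sum_(i < d) u i 0 ^+ 2 = dot u u.
  by apply: eq_bigr => i _; rewrite expr2.
by rewrite /enorm E sqr_sqrtr ?dotvv_ge0.
Qed.

Lemma enorm_ge0 u : 0 <= enorm u.
Proof. exact: sqrtr_ge0. Qed.

Lemma enorm_gt0 u : (0 < enorm u) = (u != 0).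
Proof. by rewrite lt0r enorm_ge0 andbT -sqrf_eq0 enorm_sqr dotvv_eq0. Qed.

Lemma CauchySchwarz_dot u v : dot u v ^+ 2 <= dot u u * dot v v.
Proof.
have [->|v0] := eqVneq v 0; first by rewrite !dot0r expr0n mulr0.
have vv : 0 < dot v v by rewrite dotvv_gt0.
(* This vector has squared length |v|^2 (|u|^2 |v|^2 - (u . v)^2), and |v|^2 > 0. *)
have := dotvv_ge0 (dot v v *: u - dot u v *: v).
rewrite dotBl !dotBr !dotZl !dotZr (dotC v u).
set a := dot u v; set b := dot v v in vv *; set e := dot u u => h.
rewrite -subr_ge0 -(pmulr_rge0 _ vv); congr (0 <= _) : h; ring.
Qed.

Lemma dot_le_enorm u v : dot u v <= enorm u * enorm v.
Proof.
apply: le_trans (ler_norm _) _.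
rewrite -ler_sqr ?nnegrE ?normr_ge0 ?mulr_ge0 ?enorm_ge0 //.
by rewrite exprMn !enorm_sqr real_normK ?num_real// CauchySchwarz_dot.
Qed.

Lemma enormB_le u v : enorm (u - v) <= enorm u + enorm v.
Proof.
rewrite -ler_sqr ?nnegrE ?addr_ge0 ?enorm_ge0 // enorm_sqr dotBl !dotBr (dotC v u).
have := dot_le_enorm u (- v).
have -> : enorm (- v) = enorm v.
  by rewrite /enorm; congr Num.sqrt; apply: eq_bigr => i _; rewrite mxE sqrrN.
rewrite dotNr sqrrD !enorm_sqr; lra.
Qed.

Lemma enorm_unit u : unit_sphere u -> dot u u = 1.
Proof. by rewrite /unit_sphere /= -enorm_sqr => ->; rewrite expr1n. Qed.

Lemma orth_projE x u :
  orth_proj x *m u = u - ((dot x x)^-1 * dot x u) *: x.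
Proof.
rewrite /orth_proj mulmxBl mul1mx -scalemxAl -mulmxA enorm_sqr.
have -> : x^T *m u = (dot x u)%:M.
  apply/matrixP => i j; rewrite !ord1 !mxE mulr1n.
  by apply: eq_bigr => k _; rewrite mxE.
by rewrite mul_mx_scalar scalerA.
Qed.

Lemma orth_proj_self x : orth_proj x *m x = 0.
Proof.
rewrite orth_projE; have [->|x0] := eqVneq x 0; first by rewrite scaler0 subr0.
by rewrite mulVf ?dotvv_eq0// scale1r subrr.
Qed.

(** Lets a bearing be replaced by the unnormalised difference of positions inside a projection. *)
Lemma orth_projZ c x : c != 0 -> orth_proj (c *: x) = orth_proj x.
Proof.
move=> c0; rewrite /orth_proj; congr (_ - _).
rewrite !enorm_sqr dotZl dotZr linearZ /= -scalemxAl -scalemxAr !scalerA.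
by congr (_ *: _); rewrite !invfM; move: (dot x x)^-1 => D; field.
Qed.

Lemma dot_orth_proj_unit x u : dot x x = 1 ->
  dot u (orth_proj x *m u) = dot u u - dot x u ^+ 2.
Proof.
by move=> x1; rewrite orth_projE x1 invr1 mul1r dotBr dotZr (dotC u x) expr2.
Qed.

Lemma dot_orth_proj_shift c x u : dot x x = 1 -> c *: x - u != 0 ->
  dot u (orth_proj (c *: x - u) *m x) =
  c / dot (c *: x - u) (c *: x - u) * (dot u u - dot x u ^+ 2).
Proof.
move=> x1; rewrite -dotvv_eq0 orth_projE.
rewrite !(dotBl, dotBr, dotZl, dotZr) !x1 !(dotC u x) !mulr1 => z0.
by field.
Qed.

(** The factor 1 + |u . v| is the largest eigenvalue of u u^T + v v^T. With a = u . w and b = v . w,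
    Cauchy-Schwarz for a u + b v and w gives (a^2 + b^2)^2 <= |a u + b v|^2 |w|^2, and |a u + b v|^2
    <= (1 + |u . v|) (a^2 + b^2). *)
Lemma sum_sqr_dot_le u v w : dot u u = 1 -> dot v v = 1 ->
  dot u w ^+ 2 + dot v w ^+ 2 <= (1 + `|dot u v|) * dot w w.
Proof.
move=> u1 v1.
have := CauchySchwarz_dot (dot u w *: u + dot v w *: v) w.
rewrite !dotDl !dotDr !dotZl !dotZr u1 v1 (dotC v u).
set a := dot u w; set b := dot v w; set k := dot u v; set n := dot w w => h.
have n0 : 0 <= n := dotvv_ge0 w.
have ab : 2 * (a * b * k) <= (a ^+ 2 + b ^+ 2) * `|k|.
  have h1 : a * b * k <= `|a| * `|b| * `|k| by rewrite -!normrM ler_norm.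
  have h2 : (2 * (`|a| * `|b|)) * `|k| <= (a ^+ 2 + b ^+ 2) * `|k|.
    rewrite ler_wpM2r// -(real_normK (num_real a)) -(real_normK (num_real b)).
    by have := sqr_ge0 (`|a| - `|b|); rewrite sqrrB; lra.
  by lra.
have s0 : 0 <= a ^+ 2 + b ^+ 2 by rewrite addr_ge0 ?sqr_ge0.
have [->|sN0] := eqVneq (a ^+ 2 + b ^+ 2) 0; first by rewrite mulr_ge0 ?addr_ge0.
have sgt0 : 0 < a ^+ 2 + b ^+ 2 by rewrite lt0r sN0.
rewrite -(ler_pM2l sgt0).
have {}h : (a ^+ 2 + b ^+ 2) * (a ^+ 2 + b ^+ 2) <=
    (a ^+ 2 + b ^+ 2 + 2 * (a * b * k)) * n.
  by congr (_ <= _) : h; ring.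
by apply: (le_trans h); rewrite [leRHS]mulrA ler_wpM2r//; lra.
Qed.

End Dot.

(** * Coordinatewise calculus and a Gronwall inequality *)

Section Analysis.
Context {R : realType}.

Lemma is_derive_coord (d : nat) (f : R -> 'cV[R]_d) (t : R) df i :
  is_derive (t : R^o) 1 f df -> is_derive t 1 (fun s => f s i 0) (df i 0).
Proof.
move=> [fd fE].
have fc : h^-1 *: (f (h *: (1 : R^o) + t) - f t) @[h --> 0^'] --> df.
  by rewrite -fE; apply: fd.
have gc : h^-1 *: (f (h *: (1 : R^o) + t) i 0 - f t i 0) @[h --> 0^'] --> df i 0.
  apply: cvg_trans (cvg_comp _ _ fc (@coord_continuous R d 1 i 0 df)).
  by apply: near_eq_cvg; near=> h; rewrite /= !mxE.
split; first exact: cvgP gc.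
exact: cvg_lim gc.
Unshelve. all: by end_near. Qed.

(** The product exp(k t) V(t) has nonpositive derivative for t > 0, and right-continuity extends the
    comparison to t = 0. The case k = 0 serves as a monotonicity criterion. *)
Lemma exp_decay (V dV : R -> R) (k : R) :
  (forall t : R, 0 < t -> is_derive t 1 V (dV t)) ->
  V t @[t --> 0^'+] --> V 0 ->
  (forall t : R, 0 < t -> dV t <= - k * V t) ->
  forall t : R, 0 <= t -> V t <= expR (- k * t) * V 0.
Proof.
move=> hd hc hle t t0.
pose W : R -> R := (fun s : R => expR (k * s)) * V.
have Wd (s : R) : 0 < s -> is_derive s 1 W (expR (k * s) * (dV s + k * V s)).
  move=> s0.
  have h1 : is_derive s 1 (fun s : R => expR (k * s)) (k * expR (k * s)).
    have ks : is_derive s 1 (fun s : R => k * s) k.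
      have : is_derive s 1 (k *: (@id R)) (k *: 1) by apply: is_deriveZ.
      by rewrite /GRing.scale /= mulr1.
    by rewrite mulrC; exact: (is_derive1_comp (is_derive_expR _) ks).
  have h2 := hd _ s0.
  apply: is_derive_eq; rewrite /GRing.scale /=; ring.
have ec : continuous (fun s : R => expR (k * s)).
  by move=> s; apply: continuous_comp; [exact: mulrl_continuous|exact: continuous_expR].
have Wc : W s @[s --> 0^'+] --> W 0.
  apply: cvgM hc; apply: cvg_at_right_filter; exact: ec.
have : W t <= W 0.
  apply: (@ler0_derive1_nincry _ W 0) => //.
  - by move=> s; rewrite in_itv /= andbT => /Wd [].
  - move=> s; rewrite in_itv /= andbT => s0; rewrite derive1E (@derive_val _ _ _ _ _ _ _ (Wd _ s0)).
    rewrite pmulr_rle0 ?expR_gt0//; have := hle _ s0; lra.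
  - apply/continuous_within_itvcyP; split=> // s.
    rewrite in_itv /= andbT => /Wd [Ws _].
    exact/differentiable_continuous/derivable1_diffP.
have WE s : W s = expR (k * s) * V s by [].
rewrite !WE mulr0 expR0 mul1r mulNr expRN => h.
by rewrite mulrC ler_pdivlMr ?expR_gt0// mulrC.
Qed.

Lemma is_derive_sqdist (d : nat) (f : R -> 'cV[R]_d) (t : R) df (x : 'cV[R]_d) :
  is_derive (t : R^o) 1 f df ->
  is_derive t 1 (fun s => dot (f s - x) (f s - x)) (2 * dot (f t - x) df).
Proof.
move=> fd.
have hi i : is_derive t 1 ((fun s => f s i 0) - cst (x i 0)) (df i 0).
  have h := is_derive_coord i fd.
  by apply: is_derive_eq; rewrite subr0.
have h i : is_derive t 1 (((fun s => f s i 0) - cst (x i 0)) ^+ 2)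
    (2 * ((f t - x) i 0 * df i 0)).
  have := hi i => ?.
  apply: is_derive_eq; rewrite /GRing.scale /= expr1 !mxE mulrA; congr (_ * _).
have := is_derive_sum h; rewrite -mulr_sumr.
have -> : \sum_(i < d) ((fun s => f s i 0) - cst (x i 0)) ^+ 2 =
    (fun s => dot (f s - x) (f s - x)); last by [].
apply/funext => s; rewrite fct_sumE; apply: eq_bigr => i _.
by rewrite !mxE expr2.
Qed.

Lemma cvg_sqdist (d : nat) (f : R -> 'cV[R]_d) (F : set_system R) {FF : Filter F}
    (a x : 'cV[R]_d) :
  f s @[s --> F] --> a ->
  dot (f s - x) (f s - x) @[s --> F] --> dot (a - x) (a - x).
Proof.
move=> fa; apply: cvg_big => [|i _]; first exact: add_continuous.
have h : (f s - x) i 0 @[s --> F] --> (a - x) i 0.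
  exact: cvg_comp (cvgB fa (cvg_cst x)) (@coord_continuous R d 1 i 0 (a - x)).
exact: (cvgM h h).
Qed.

End Analysis.

(** * Bearing formations and the error dynamics of the follower *)

Section Formation.
Context {R : realType} {d m : nat}.
Implicit Types (g : 'I_m -> 'cV[R]_d) (p : configuration R d m).

Lemma bearing_fiber_leader g p j : bearing_fiber g p ->
  p (leader j) = p follower + enorm (p (leader j) - p follower) *: g j.
Proof.
move=> [pd <-]; rewrite /bearing_function /bearing scalerA mulfV ?scale1r.
  by rewrite addrC subrK.
by rewrite gt_eqF// enorm_gt0 subr_eq0.
Qed.

(** Equality would force g_i = c g_j with c = g_i . g_j, placing leaders i and j of the noncollinear
    configuration on the line through its follower directed by g_j. The bound concerns [g] alone, so
    it serves every configuration in the fiber. *)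
Lemma noncollinear_dot_lt1 g i j : (forall k, unit_sphere (g k)) ->
  noncollinear_realizable g -> i != j -> `|dot (g i) (g j)| < 1.
Proof.
move=> gu [_ [p pg ncol]] ij.
have g1 k : dot (g k) (g k) = 1 := enorm_unit (gu k).
set c := dot (g i) (g j).
have c2 : c ^+ 2 <= 1 by have := CauchySchwarz_dot (g i) (g j); rewrite !g1 mulr1.
have c1 : `|c| <= 1 by rewrite -sqrtr_sqr -sqrtr1 ler_sqrt.
rewrite lt_neqAle c1 andbT; apply/eqP => cE.
have {}cE : c ^+ 2 = 1 by rewrite -real_normK ?num_real// cE expr1n.
have gi : g i = c *: g j.
  apply/eqP; rewrite -subr_eq0 -dotvv_eq0 dotBl !dotBr !dotZl !dotZr !g1.
  by rewrite (dotC (g j)) -/c; apply/eqP; lra.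
apply: (ncol i j ij); exists (p follower), (g j); split.
  by rewrite -dotvv_eq0 g1 oner_eq0.
move=> y [->|->|->].
- rewrite (bearing_fiber_leader i pg) gi scalerA.
  by exists (enorm (p (leader i) - p follower) * c).
- rewrite {1}(bearing_fiber_leader j pg).
  by exists (enorm (p (leader j) - p follower)).
- by exists 0; rewrite scale0r addr0.
Qed.

Lemma orth_proj_gap_ge0 (u w : 'cV[R]_d) : dot u u = 1 ->
  0 <= dot w w - dot u w ^+ 2.
Proof. by move=> u1; have := CauchySchwarz_dot u w; rewrite u1 mul1r subr_ge0. Qed.

(** Each summand is |P_{g_k} w|^2 >= 0. The terms i and j alone give at least 2 |w|^2 - (1 + |g_i .
    g_j|) |w|^2. *)
Lemma sum_orth_proj_coercive g i j (w : 'cV[R]_d) :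
  (forall k, dot (g k) (g k) = 1) -> i != j ->
  (1 - `|dot (g i) (g j)|) * dot w w <= \sum_k (dot w w - dot (g k) w ^+ 2).
Proof.
move=> g1 ij; rewrite (bigD1 i)//= (bigD1 j) 1?eq_sym//=.
have := sum_sqr_dot_le w (g1 i) (g1 j).
have : 0 <= \sum_(k | (k != i) && (k != j)) (dot w w - dot (g k) w ^+ 2).
  by apply: sumr_ge0 => k _; exact: orth_proj_gap_ge0.
lra.
Qed.

Lemma unitmx_injective n (A : 'M[R]_n) :
  (forall w : 'cV[R]_n, A *m w = 0 -> w = 0) -> A \in unitmx.
Proof.
move=> inj; rewrite -unitmx_tr -row_free_unit -kermx_eq0; apply/eqP.
apply/row_matrixP => i; rewrite row0.
apply: trmx_inj; rewrite trmx0; apply: inj.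
by rewrite -{1}[A]trmxK -trmx_mul -row_mul mulmx_ker row0 trmx0.
Qed.

Lemma dot_velocity g p x (c : 'I_m -> R) :
  (forall k, dot (g k) (g k) = 1) -> bearings_defined p ->
  (forall j, p (leader j) = x + c j *: g j) ->
  let e := p follower - x in
  dot e (velocity g p follower) =
  - \sum_j (c j / enorm (c j *: g j - e) ^+ 2 * (dot e e - dot (g j) e ^+ 2)).
Proof.
move=> g1 pd px e; rewrite /velocity eqxx dotNr dot_sumr; congr (- _).
apply: eq_bigr => j _.
have zE : p (leader j) - p follower = c j *: g j - e.
  by rewrite px /e opprB addrCA addrA (addrC x).
have z0 : c j *: g j - e != 0 by rewrite -zE subr_eq0.
rewrite /bearing zE orth_projZ ?invr_eq0 ?gt_eqF ?enorm_gt0//.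
by rewrite dot_orth_proj_shift// enorm_sqr.
Qed.

(** The squared distance to the initial position has zero derivative and starts at 0, so [exp_decay]
    with k = 0 keeps it at 0. *)
Lemma leader_constant g (p : R -> configuration R d m) j (t : R) :
  trajectory g p -> 0 <= t -> p t (leader j) = p 0 (leader j).
Proof.
move=> [_ pc pd] t0.
have vl s : velocity g (p s) (leader j) = 0.
  by rewrite /velocity /leader /follower eq_sym (negbTE (neq_lift _ _)).
set a := p 0 (leader j).
pose V s := dot (p s (leader j) - a) (p s (leader j) - a).
have V0 : V 0 = 0 by rewrite /V subrr dot0r.
have : V t <= expR (- 0 * t) * V 0.
  apply: (@exp_decay R V (fun=> 0)) => //.
  - move=> s s0; have := is_derive_sqdist a (pd s s0 (leader j)).
    by rewrite vl dot0r mulr0.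
  - exact: cvg_sqdist (pc (leader j)).
  - by move=> s _; rewrite oppr0 mul0r.
rewrite V0 mulr0 => Vt.
by apply/eqP; rewrite -subr_eq0 -dotvv_eq0 eq_le Vt dotvv_ge0.
Qed.

(** Two passes of [exp_decay]: the first, with k = 0, confines the error to the ball of radius [r];
    there [k] bounds every c_j / |z_j|^2 from below, which gives the rate in the second. *)
Lemma follower_decay g (x : 'cV[R]_d) (c : 'I_m -> R) (mu r : R)
    (p : R -> configuration R d m) (k : R) :
  (forall j, dot (g j) (g j) = 1) ->
  (forall w, mu * dot w w <= \sum_j (dot w w - dot (g j) w ^+ 2)) ->
  (forall j, 0 < c j) ->
  0 <= k -> (forall j, k <= c j / (c j + r) ^+ 2) ->
  trajectory g p -> (forall j, p 0 (leader j) = x + c j *: g j) ->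
  enorm (p 0 follower - x) <= r ->
  forall t : R, 0 <= t ->
    enorm (p t follower - x) <= expR (- (k * mu) * t) * enorm (p 0 follower - x).
Proof.
move=> g1 coer c0 k0 kc tp px r0.
have [pd pc pder] := tp.
pose e (t : R) := p t follower - x.
pose V t := dot (e t) (e t).
pose dV t := 2 * dot (e t) (velocity g (p t) follower).
have Vd (t : R) : 0 < t -> is_derive t 1 V (dV t).
  by move=> t0; exact: is_derive_sqdist (pder t t0 follower).
have Vc : V t @[t --> 0^'+] --> V 0 .
  exact: cvg_sqdist (pc follower).
have dVE (t : R) : 0 < t -> dV t = - (2 * \sum_j
    (c j / enorm (c j *: g j - e t) ^+ 2 * (V t - dot (g j) (e t) ^+ 2))).
  move=> t0; rewrite /dV (@dot_velocity _ _ x c) ?mulrN//; first exact/pd/ltW.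
  by move=> j; rewrite (leader_constant _ tp (ltW t0)).
have er (t : R) : 0 <= t -> enorm (e t) <= r.
  move=> t0; apply: le_trans r0.
  rewrite -ler_sqr ?nnegrE ?enorm_ge0// !enorm_sqr.
  have := @exp_decay R V dV 0 Vd Vc _ t t0.
  rewrite oppr0 mul0r expR0 mul1r; apply=> s s0.
  rewrite mul0r dVE// oppr_le0 mulr_ge0// sumr_ge0// => j _.
  by rewrite mulr_ge0 ?orth_proj_gap_ge0// divr_ge0 ?sqr_ge0// ltW.
have decay (t : R) : 0 < t -> dV t <= - (2 * (k * mu)) * V t.
  move=> t0; rewrite dVE// mulNr lerN2 -[leLHS]mulrA ler_pM2l//.
  rewrite -mulrA (le_trans (ler_wpM2l k0 (coer (e t))))// mulr_sumr.
  apply: ler_sum => j _; rewrite ler_wpM2r ?orth_proj_gap_ge0//.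
  apply: le_trans (kc j) _; rewrite ler_pM2l//.
  have zE : p t (leader j) - p t follower = c j *: g j - e t.
    by rewrite (leader_constant _ tp (ltW t0)) px /e opprB addrCA addrA (addrC x).
  have z0 : 0 < enorm (c j *: g j - e t).
    by rewrite -zE enorm_gt0 subr_eq0 (pd _ (ltW t0)).
  (* Triangle inequality, with |c_j g_j| = c_j. *)
  have zr : enorm (c j *: g j - e t) <= c j + r.
    apply: (le_trans (enormB_le _ _)); apply: lerD; last exact/er/ltW.
    rewrite -ler_sqr ?nnegrE ?enorm_ge0 ?(ltW (c0 j))// enorm_sqr dotZl dotZr.
    by rewrite g1 mulr1 expr2.
  have cr0 := lt_le_trans z0 zr.
  by rewrite lef_pV2 ?posrE ?exprn_gt0// ler_sqr// nnegrE ltW.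
move=> t t0.
(* [V] is the squared error, so its rate 2 k mu becomes k mu for the norm. *)
rewrite -ler_sqr ?nnegrE ?enorm_ge0 ?mulr_ge0 ?expR_ge0 ?enorm_ge0//.
rewrite exprMn !enorm_sqr -expRM_natl.
have := exp_decay Vd Vc decay t0.
by rewrite mulNr -mulrA mulNr mulrN.
Qed.

End Formation.

Theorem theorem1 (R : realType) (d m : nat) (hn : (3 <= m.+1)%N)
    (g : 'I_m -> 'cV[R]_d) (hg : forall j : 'I_m, unit_sphere (g j))
    (hA1 : noncollinear_realizable g)
    (p : configuration R d m) (hp : bearing_fiber g p) :
  let S : 'M[R]_d := \sum_(j < m) orth_proj (g j) in
  let x : 'cV[R]_d :=
    invmx S *m (\sum_(j < m) orth_proj (g j) *m p (leader j)) in
  [/\ S \in unitmx,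
      p follower = x,
      equilibrium g (place_follower p x) &
      globally_exponentially_stable (follower_motions g p) x].
Proof.
move=> S x.
have g1 j : dot (g j) (g j) = 1 := enorm_unit (hg j).
have [pd pg] := hp.
(* At least three agents means at least two leaders, whose bearings supply the coercivity
   constant. *)
have m1 : (1 < m)%N by [].
pose i0 : 'I_m := Ordinal (ltnW m1); pose i1 : 'I_m := Ordinal m1.
have i01 : i0 != i1 by [].
pose mu := 1 - `|dot (g i0) (g i1)|.
have mu0 : 0 < mu by rewrite subr_gt0 noncollinear_dot_lt1.
have coer w : mu * dot w w <= \sum_j (dot w w - dot (g j) w ^+ 2).
  exact: sum_orth_proj_coercive.
(* If S w = 0, then 0 = w . S w >= mu |w|^2, so w = 0. *)
have Su : S \in unitmx.
  apply: unitmx_injective => w Sw0.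
  have := coer w.
  under eq_bigr do rewrite -dot_orth_proj_unit//.
  rewrite -dot_sumr -mulmx_suml Sw0 dot0r pmulr_rle0// => w0.
  by apply/eqP; rewrite -dotvv_eq0 eq_le w0 dotvv_ge0.
pose c j := enorm (p (leader j) - p follower).
have c0 j : 0 < c j by rewrite enorm_gt0 subr_eq0.
have pl j : p (leader j) = p follower + c j *: g j := bearing_fiber_leader j hp.
(* P_{g_j} kills p_j - p_n = c_j g_j, so the sum of the P_{g_j} p_j is S p_n. *)
have px : p follower = x.
  rewrite /x; apply: (canRL (mulKmx Su)); rewrite /S mulmx_suml.
  apply: eq_bigr => j _.
  by rewrite pl mulmxDr -scalemxAr orth_proj_self scaler0 addr0.
split=> //.
- have -> : place_follower p x = p.
    by apply/funext => i; rewrite /place_follower -px; case: eqP => [->|].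
  split=> // i; rewrite /velocity; case: ifP => // _.
  rewrite big1 ?oppr0// => j _.
  by rewrite -/(bearing_function p j) pg orth_proj_self.
(* K = 1 because the squared error satisfies the decay inequality from time 0 on, without transient
   growth. *)
- exists 1 => // r r0.
  (* The default 1 only caps the minimum: [k] stays positive and below every term, and depends on
     the motion only through [r]. *)
  pose k := \big[Num.min/1]_j (c j / (c j + r) ^+ 2).
  have k0 : 0 < k.
    by apply: lt_bigmin => // j _; rewrite divr_gt0// exprn_gt0// addr_gt0.
  exists (k * mu); first exact: mulr_gt0.
  move=> y [q [tq q0 yE]]; rewrite !yE => yr t t0; rewrite yE mul1r.
  apply: (follower_decay g1 coer c0 (ltW k0) _ tq _ yr t0) => j.
    exact: bigmin_le.
  by rewrite q0 pl px.
Qed.
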